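(* Let $E$ be a Banach lattice and let $T = (T(t))_{t \ge 0}$ be a positive $C_0$-semigroup on $E$. The following assertions are equivalent: (i) For each $x \in E$, the net $(T(t)x)_{t \in (0,\infty)}$ converges relatively uniformly to $x$ as $t \downarrow 0$ (i.e. the semigroup $T$ is relatively uniformly continuous). (ii) For each $x \in E$, the net $(T(t)x)_{t \in (0,\infty)}$ order converges to $x$ as $t \downarrow 0$. (iii) For each $x \in E$ there exists $t_x > 0$ such that the set $\{T(t)x : t \in [0,t_x]\}$ is order bounded in $E$. (iv) For each $x \in E$ and each $t_0 > 0$ the set $\{T(t)x : t \in [0,t_0]\}$ is order bounded in $E$.
   Context: Banach lattices are real; $E_+$ denotes the positive cone of $E$. A positive $C_0$-semigroup on $E$ is a strongly continuous one-parameter semigroup of bounded linear operators $T(t)$ on $E$ such that every $T(t)$ is positive, i.e. maps $E_+$ into $E_+$. Order convergence: a net $(x_j)_{j\in J}$ in $E$ order converges to $x \in E$ if there exists a decreasing net $(y_h)_{h \in H}$ in $E_+$ (with possibly different index set $H$) with infimum $0$ such that for each $h \in H$ there exists $j_0 \in J$ with $|x_j - x| \le y_h$ for all $j \succeq j_0$. Relatively uniform convergence: a net $(x_j)_{j \in J}$ in $E$ converges relatively uniformly to $x \in E$ if there exists $u \in E_+$ (called a regulator) such that for every $\varepsilon > 0$ there exists $j_0 \in J$ with $|x_j - x| \le \varepsilon u$ for all $j \succeq j_0$. ''As $t \downarrow 0$'' means that the index set $(0,\infty)$ is directed by the converse of the usual order of $\mathbb{R}$. A set is order bounded if it is contained in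 some order interval $[a,b] = \{z \in E : a \le z \le b\}$. *)

(* Defs.v *)
From HB Require Import structures.
From mathcomp Require Import all_boot all_order all_algebra.
From mathcomp Require Import all_classical all_reals all_analysis.

Set Implicit Arguments.
Unset Strict Implicit.
Unset Printing Implicit Defensive.

Import Order.TTheory GRing.Theory Num.Theory.
Import numFieldNormedType.Exports.

Local Open Scope classical_set_scope.
Local Open Scope ring_scope.

(* Hierarchy Builder rejects the join of [CompleteNormedModule] with any of the
   structures of order.v (it should have been declared before [numDomainType]).
   The lattice order is therefore given by the fields of this mixin, in the
   form expected by order.v, and the library structure [latticeType] is put on
   the alias [lattice_of E] of E below. *)
HB.mixin Record isBanachLattice (R : realType) (E : Type)
    of CompleteNormedModule R E := {
  lev : rel E;
  meetv : E -> E -> E;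
  joinv : E -> E -> E;
  lev_refl : reflexive lev;
  lev_anti : antisymmetric lev;
  lev_trans : transitive lev;
  levI : forall x y z : E, lev x (meetv y z) = lev x y && lev x z;
  leUv : forall x y z : E, lev (joinv x y) z = lev x z && lev y z;
  lev_add2r : forall z x y : E, lev x y -> lev (x + z) (y + z);
  scalev_ge0 : forall (a : R) (x : E), 0 <= a -> lev 0 x -> lev 0 (a *: x);
  lattice_norm : forall x y : E,
    lev (joinv x (- x)) (joinv y (- y)) -> `|x| <= `|y|
}.

#[short(type="banachLatticeType")]
HB.structure Definition BanachLattice (R : realType) :=
  { E of isBanachLattice R E & CompleteNormedModule R E }.

Fact lattice_of_display : Order.disp_t. Proof. exact: Order.Disp tt tt. Qed.

Definition lattice_of (R : realType) (E : banachLatticeType R) : Type := E.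

HB.instance Definition _ (R : realType) (E : banachLatticeType R) :=
  Choice.copy (lattice_of E) E.
HB.instance Definition _ (R : realType) (E : banachLatticeType R) :=
  Order.Le_isPOrder.Build lattice_of_display (lattice_of E)
    (@lev_refl R E) (@lev_anti R E) (@lev_trans R E).
HB.instance Definition _ (R : realType) (E : banachLatticeType R) :=
  Order.POrder_isMeetSemilattice.Build lattice_of_display (lattice_of E)
    (@levI R E).
HB.instance Definition _ (R : realType) (E : banachLatticeType R) :=
  Order.POrder_isJoinSemilattice.Build lattice_of_display (lattice_of E)
    (@leUv R E).

Notation "x <=v y" := (Order.le (x : lattice_of _) (y : lattice_of _))
  (at level 70, no associativity) : ring_scope.

(* The absolute value of x in E, as opposed to its norm `|x| : R. *)
Definition absv (R : realType) (E : banachLatticeType R) (x : E) : E :=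
  Order.join (x : lattice_of E) (- x : lattice_of E).

Definition order_bounded (R : realType) (E : banachLatticeType R)
    (A : set E) : Prop :=
  exists a b : lattice_of E, A `<=` `[a, b].

Record is_directed (J : Type) (leJ : J -> J -> Prop) : Prop := {
  directed_nonempty : inhabited J;
  directed_refl : forall i, leJ i i;
  directed_trans : forall i j k, leJ i j -> leJ j k -> leJ i k;
  directed_ub : forall i j, exists k, leJ i k /\ leJ j k
}.

Definition order_cvg (R : realType) (E : banachLatticeType R)
    (J : Type) (leJ : J -> J -> Prop) (x : J -> E) (l : E) : Prop :=
  exists (H : Type) (leH : H -> H -> Prop) (y : H -> lattice_of E),
    [/\ is_directed leH,
        forall h k, leH h k -> y k <=v y h,
        infimums (range y) (0 : E)
      & forall h, exists j0, forall j, leJ j0 j -> absv (x j - l) <=v y h].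

Definition ru_cvg (R : realType) (E : banachLatticeType R)
    (J : Type) (leJ : J -> J -> Prop) (x : J -> E) (l : E) : Prop :=
  exists u : E, (0 : E) <=v u /\
    forall e : R, 0 < e ->
      exists j0, forall j, leJ j0 j -> absv (x j - l) <=v (e *: u).

(* The direction t \downarrow 0 of the index set (0, +oo). *)
Definition dir0 (R : realType) (s t : {posnum R}) : Prop :=
  t%:num <= s%:num.

Lemma dir0_directed (R : realType) : is_directed (@dir0 R).
Proof.
split=> [|s|s t u|s t]; rewrite /dir0.
- exact: (inhabits 1%:pos).
- exact: lexx.
- by move=> ts ut; exact: le_trans ut ts.
- have [st|ts] := leP s%:num t%:num; first by exists s; split.
  by exists t; split=> //; exact: ltW.
Qed.

(* The semigroup is indexed by [0, +oo[: the values T t at t < 0 are never used. *)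
Record positive_C0_semigroup (R : realType) (E : banachLatticeType R)
    (T : R -> E -> E) : Prop := {
  semigroup_linear : forall t : R, 0 <= t -> linear (T t);
  semigroup_bounded : forall t : R, 0 <= t ->
    exists M : R, forall x, `|T t x| <= M * `|x|;
  semigroup0 : forall x, T 0 x = x;
  semigroupD : forall s t : R, 0 <= s -> 0 <= t ->
    forall x, T (s + t) x = T s (T t x);
  semigroup_continuous : forall x, {within `[0, +oo[, continuous (T ^~ x)};
  semigroup_positive : forall t : R, 0 <= t ->
    forall x : E, (0 : E) <=v x -> (0 : E) <=v T t x
}.

(* Main.v *)
Require Import Defs.
From mathcomp Require Import all_boot all_order all_algebra.
From mathcomp Require Import all_classical all_reals all_analysis.
From mathcomp Require Import ring.
Set Implicit Arguments.
Unset Strict Implicit.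
Unset Printing Implicit Defensive.
Import Order.TTheory GRing.Theory Num.Theory.
Import numFieldNormedType.Exports.
Local Open Scope classical_set_scope.
Local Open Scope ring_scope.

(** For (iv) => (i): by positivity, orbit bounds on [0, 1] can be chosen with
    norm at most [C * `|x|]. The mean [a] of an orbit over [0, h] satisfies
    [absv (T t a - a) <=v t *: v] for [t <= 1], and tends to [x] as [h -> 0]; it
    is obtained as the limit of Riemann sums, which are Cauchy by common
    refinement, so no integral of [E]-valued functions is required. Taking such
    means [a n] with [`|a n - x| <= 4 ^- n], the bounds [u n] of the orbits of
    [a n - x] and the vectors [v n] are, up to scalar factors ([2 ^- n] for
    [u n]), dominated by one single regulator. *)

(** * Order, absolute value and norm in a Banach lattice *)

Section BanachLattices.
Variables (R : realType) (E : banachLatticeType R).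
Implicit Types (x y z u v w : E) (a e : R).

Lemma vle_refl x : x <=v x.
Proof. exact: lexx. Qed.

Lemma vle_trans y x z : x <=v y -> y <=v z -> x <=v z.
Proof. exact: le_trans. Qed.

Lemma vle_add2r z x y : (x + z <=v y + z) = (x <=v y).
Proof.
apply/idP/idP => [|h]; last exact: lev_add2r.
by move=> /(lev_add2r (- z)); rewrite !addrK.
Qed.

Lemma subv_ge0 x y : (0 <=v y - x) = (x <=v y).
Proof. by rewrite -(vle_add2r x) add0r subrK. Qed.

Lemma vleD x y z w : x <=v y -> z <=v w -> x + z <=v y + w.
Proof.
move=> xy zw; apply: (@vle_trans (y + z)); first by rewrite vle_add2r.
by rewrite addrC [y + w]addrC vle_add2r.
Qed.

Lemma addv_ge0 x y : 0 <=v x -> 0 <=v y -> 0 <=v x + y.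
Proof. by move=> x0 /(vleD x0); rewrite addr0. Qed.

Lemma vleN2 x y : (- x <=v - y) = (y <=v x).
Proof. by rewrite -subv_ge0 opprK addrC subv_ge0. Qed.

Lemma sumv_ge0 (I : Type) (r : seq I) (P : pred I) (F : I -> E) :
  (forall i, 0 <=v F i) -> 0 <=v \sum_(i <- r | P i) F i.
Proof.
move=> F0; elim/big_rec : _ => [|i x _ x0]; first exact: vle_refl.
exact: addv_ge0.
Qed.

Lemma vle_sum (I : Type) (r : seq I) (P : pred I) (F G : I -> E) :
  (forall i, P i -> F i <=v G i) ->
  \sum_(i <- r | P i) F i <=v \sum_(i <- r | P i) G i.
Proof.
move=> FG; elim/big_rec2 : _ => [|i x y Pi]; first exact: vle_refl.
exact/vleD/FG.
Qed.

Lemma scalev_vge0 a x : 0 <= a -> 0 <=v x -> 0 <=v a *: x.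
Proof. exact: scalev_ge0. Qed.

Lemma vleZ a x y : 0 <= a -> x <=v y -> a *: x <=v a *: y.
Proof.
move=> a0 xy; rewrite -subv_ge0 -scalerBr; apply: scalev_vge0 => //.
by rewrite subv_ge0.
Qed.

Lemma vleZl a b x : a <= b -> 0 <=v x -> a *: x <=v b *: x.
Proof.
by move=> ab x0; rewrite -subv_ge0 -scalerBl scalev_vge0// subr_ge0.
Qed.

Lemma absv_le x y : (absv x <=v y) = (x <=v y) && (- x <=v y).
Proof. exact: leUx. Qed.

Lemma vle_absv x : x <=v absv x.
Proof. exact: leUl. Qed.

Lemma vleN_absv x : - x <=v absv x.
Proof. exact: leUr. Qed.

Lemma vge0_double x : 0 <=v x + x -> 0 <=v x.
Proof.
move=> /(@scalev_vge0 2^-1 _ _); rewrite invr_ge0 ler0n => /(_ isT).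
by rewrite -mulr2n -[x *+ 2]scaler_nat scalerA mulVf ?pnatr_eq0// scale1r.
Qed.

Lemma absv_ge0 x : 0 <=v absv x.
Proof.
apply: vge0_double; rewrite -(subrr x).
by apply: vleD; [exact: vle_absv|exact: vleN_absv].
Qed.

Lemma absv_id x : 0 <=v x -> absv x = x.
Proof.
move=> x0; have h : absv x <=v x.
  rewrite absv_le vle_refl/=; apply: vle_trans (x0).
  by rewrite -[0]oppr0 vleN2.
exact/(@lev_anti R E)/andP/(conj h)/vle_absv.
Qed.

Lemma absvN x : absv (- x) = absv x.
Proof. by rewrite /absv opprK; exact: (@joinC _ (lattice_of E)). Qed.

Lemma absvD x y : absv (x + y) <=v absv x + absv y.
Proof.
rewrite absv_le opprD; apply/andP; split; apply: vleD;
  by [exact: vle_absv|exact: vleN_absv].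
Qed.

Lemma absv_sum (I : Type) (r : seq I) (P : pred I) (F G : I -> E) :
  (forall i, P i -> absv (F i) <=v G i) ->
  absv (\sum_(i <- r | P i) F i) <=v \sum_(i <- r | P i) G i.
Proof.
move=> FG; rewrite absv_le -sumrN; apply/andP; split; apply: vle_sum => i /FG;
  by rewrite absv_le => /andP[].
Qed.

Lemma absvZ_le a x y : 0 <= a -> absv x <=v y -> absv (a *: x) <=v a *: y.
Proof.
move=> a0; rewrite !absv_le -scalerN => /andP[xy Nxy].
by rewrite !vleZ.
Qed.

Lemma absv_norm x y : absv x <=v absv y -> `|x| <= `|y|.
Proof. exact: lattice_norm. Qed.

Lemma normv_absv x : `|absv x| = `|x|.
Proof.
apply/eqP; rewrite eq_le; apply/andP; split; apply: absv_norm;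
  by rewrite (absv_id (absv_ge0 x)) vle_refl.
Qed.

Lemma norm_absv_le x y : absv x <=v y -> `|x| <= `|y|.
Proof.
move=> xy; apply: absv_norm; apply: (vle_trans xy); exact: vle_absv.
Qed.

Lemma normv_le x y : 0 <=v x -> x <=v y -> `|x| <= `|y|.
Proof. by move=> x0 xy; apply: norm_absv_le; rewrite absv_id. Qed.

(* The negative part of [x] is dominated by [|x - z|] for every [z >= 0]. *)
Lemma vge0_closed x :
  (forall e, 0 < e -> exists2 z, 0 <=v z & `|x - z| <= e) -> 0 <=v x.
Proof.
move=> h; pose n : E := Order.join (- x : lattice_of E) (0 : lattice_of E).
have n0 : 0 <=v n by exact: leUr.
have xn : - x <=v n by exact: leUl.
suff /eqP : `|n| = 0.
  by rewrite normr_eq0 => /eqP n_eq; rewrite -[x]opprK -oppr0 vleN2 -n_eq.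
apply/eqP; rewrite eq_le normr_ge0 andbT; apply/ler_addgt0Pr => e /h[z z0 xz].
rewrite add0r; apply: le_trans xz; rewrite -[`|x - z|]normv_absv.
apply: normv_le => //; apply: etrans (leUx _ _ _) _.
apply/andP; split; last exact: absv_ge0.
apply: (@vle_trans (- (x - z))); last exact: vleN_absv.
by rewrite vleN2 -subv_ge0 opprB addrC subrK.
Qed.

(** The positive cone is closed, and [y - x] is approximated by [y' - x']; errors of [e / 2] on the
    two sides add up to [e]. *)
Lemma vle_closed x y : (forall e, 0 < e -> exists x' y',
  [/\ x' <=v y', `|x - x'| <= e & `|y - y'| <= e]) -> x <=v y.
Proof.
move=> h; rewrite -subv_ge0; apply: vge0_closed => e e0.
have /h[x' [y' [xy xx yy]]] : 0 < e / 2 by rewrite divr_gt0.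
exists (y' - x'); first by rewrite subv_ge0.
have -> : y - x - (y' - x') = (y - y') - (x - x').
  by rewrite !opprB addrACA [RHS]addrACA [- x - y']addrC.
by rewrite [e]splitr (le_trans (ler_normB _ _))// lerD.
Qed.

Lemma absv_closed x y :
  (forall e, 0 < e -> exists2 x', absv x' <=v y & `|x - x'| <= e) ->
  absv x <=v y.
Proof.
move=> h; rewrite absv_le; apply/andP; split; apply: vle_closed => e /h[x'].
  rewrite absv_le => /andP[xy _] xx; exists x', y; split => //.
  by rewrite subrr normr0 (le_trans _ xx).
rewrite absv_le => /andP[_ xy] xx; exists (- x'), y; split => //.
  by rewrite -opprD normrN.
by rewrite subrr normr0 (le_trans _ xx).
Qed.

(** * Limits and dominating sums obtained from completeness *)

Lemma cauchy_limit (a : nat -> E) :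
  (forall e, 0 < e -> exists N, forall m n,
     (N <= m)%N -> (N <= n)%N -> `|a m - a n| <= e) ->
  exists l, forall e, 0 < e -> exists N, forall n,
     (N <= n)%N -> `|l - a n| <= e.
Proof.
move=> h; have /cauchy_cvgP cv : cauchy (a @ \oo).
  apply: cauchy_exP => e e0; have /h[N hN] : 0 < e / 2 by rewrite divr_gt0.
  exists (a N); exists N => // n /= Nn; rewrite -ball_normE /=.
  apply: le_lt_trans (hN _ _ (leqnn N) Nn) _.
  by rewrite ltr_pdivrMr// mulr_natr mulr2n ltrDl.
exists (lim (a @ \oo)) => e e0.
by move/cvgrPdist_le : cv => /(_ e e0)[N _ hN]; exists N.
Qed.

(** The series of the [w n] converges absolutely by comparison with a geometric series. Its sum
    dominates each term, since all terms are positive and the order is closed. *)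
Lemma dominating_vector (w : nat -> E) (K : R) :
  (forall n, 0 <=v w n) -> (forall n, `|w n| <= K * 2 ^- n) ->
  exists2 u, 0 <=v u & forall n, w n <=v u.
Proof.
move=> w0 wK.
have cvn : cvgn [normed series w].
  apply: (@series_le_cvg _ _ (geometric K 2^-1)) => [n|n|n|].
  - exact: normr_ge0.
  - by rewrite /= exprVn; apply: le_trans (wK n).
  - by rewrite /= exprVn.
  - apply: is_cvg_geometric_series; rewrite gtr0_norm ?invr_gt0//.
    by rewrite invf_lt1// ltr1n.
have /cvgrPdist_le cv := normed_cvg cvn.
set u := lim _ in cv.
have wu n : w n <=v u.
  apply: vle_closed => e e0; have [N _ hN] := cv e e0.
  (* At least [N] terms make the partial sum close to [u]; at least [n.+1] terms make [w n] one of
     the summands. *)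
  exists (w n), (series w (maxn N n.+1)); split.
  - rewrite /series /= big_mkord (bigD1 (Ordinal (leq_maxr N n.+1)))//=.
    rewrite -[X in X <=v _]addr0; apply: vleD; first exact: vle_refl.
    exact: sumv_ge0.
  - by rewrite subrr normr0 ltW.
  - by apply: hN; rewrite /= leq_maxl.
by exists u => //; apply: vle_trans (wu 0%N).
Qed.

End BanachLattices.

(** * Rearranged finite sums and mesh sizes *)

Lemma sum_mul_nat (V : zmodType) (f : nat -> V) (n m : nat) :
  \sum_(0 <= i < n * m) f i =
  \sum_(0 <= k < n) \sum_(0 <= j < m) f (k * m + j)%N.
Proof.
rewrite big_nat_mul; apply: eq_bigr => k _.
rewrite -{1}[(k * m)%N]add0n big_addn mulSn addnK.
by apply: eq_bigr => j _; rewrite addnC.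
Qed.

(** Induction on the shift: raising [j] by one adds to the left side a telescoping sum with value
    [f (n + j) - f j]. *)
Lemma sum_shiftB (V : zmodType) (f : nat -> V) (n j : nat) :
  \sum_(0 <= k < n) (f (k + j)%N - f k) =
  \sum_(0 <= k < j) (f (n + k)%N - f k).
Proof.
elim: j => [|j IH].
  by rewrite [RHS]big_geq// big1// => k _; rewrite addn0 subrr.
rewrite big_nat_recr//= -IH -[j in f j]add0n.
rewrite -(telescope_sumr (fun k => f (k + j)%N) (leq0n n)) -big_split.
by apply: eq_bigr => k _; rewrite /= addSnnS [RHS]addrC addrA subrK.
Qed.

(** [d^-1] is less than its truncation plus one, hence at most [n.+1]. *)
Lemma div_succn_truncn_le (R : realType) (h d : R) (n : nat) :
  h <= 1 -> 0 < d -> (Num.truncn d^-1 <= n)%N -> h / n.+1%:R <= d.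
Proof.
move=> h1 d0 dn; rewrite ler_pdivrMr ?ltr0n// (le_trans h1)//.
rewrite -ler_pdivrMl// mulr1.
have /Num.Theory.truncn_itv/andP[_ /ltW/le_trans] : 0 <= d^-1.
  by rewrite invr_ge0 ltW.
by apply; rewrite ler_nat.
Qed.

(** * Linearity, monotonicity and continuity at zero of a positive semigroup *)

Section PositiveSemigroups.
Variables (R : realType) (E : banachLatticeType R) (T : R -> E -> E).
Hypothesis hT : positive_C0_semigroup T.
Implicit Types (x y u v : E) (s t : R).

Lemma semigroupZD t (a : R) x y : 0 <= t ->
  T t (a *: x + y) = a *: T t x + T t y.
Proof. by move=> t0; exact: (semigroup_linear hT t0). Qed.

Lemma semigroup_add t x y : 0 <= t -> T t (x + y) = T t x + T t y.
Proof. by move=> t0; have := semigroupZD 1 x y t0; rewrite !scale1r. Qed.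

Lemma semigroup_v0 t : 0 <= t -> T t 0 = 0.
Proof.
by move=> t0; apply: (@addrI _ (T t 0)); rewrite -semigroup_add// !addr0.
Qed.

Lemma semigroupZ t (a : R) x : 0 <= t -> T t (a *: x) = a *: T t x.
Proof.
by move=> t0; have := semigroupZD a x 0 t0; rewrite semigroup_v0// !addr0.
Qed.

Lemma semigroupN t x : 0 <= t -> T t (- x) = - T t x.
Proof. by move=> t0; rewrite -scaleN1r semigroupZ// scaleN1r. Qed.

Lemma semigroupB t x y : 0 <= t -> T t (x - y) = T t x - T t y.
Proof. by move=> t0; rewrite semigroup_add// semigroupN. Qed.

Lemma semigroup_sum t (r : seq nat) (F : nat -> E) : 0 <= t ->
  T t (\sum_(i <- r) F i) = \sum_(i <- r) T t (F i).
Proof.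
move=> t0; apply: (big_morph (T t)); last exact: semigroup_v0.
by move=> x y; exact: semigroup_add.
Qed.

Lemma semigroup_mono t x y : 0 <= t -> x <=v y -> T t x <=v T t y.
Proof.
move=> t0 xy; rewrite -subv_ge0 -semigroupB//.
apply: (semigroup_positive hT) => //.
by rewrite subv_ge0.
Qed.

Lemma absv_semigroup t x y : 0 <= t -> absv x <=v y -> absv (T t x) <=v T t y.
Proof.
move=> t0; rewrite !absv_le -semigroupN// => /andP[xy Nxy].
by rewrite !semigroup_mono.
Qed.

Lemma semigroup_cvg0 x (e : R) : 0 < e ->
  exists2 d, 0 < d <= 1 & forall s, 0 <= s <= d -> `|T s x - x| <= e.
Proof.
move=> e0; have /subspace_continuousP/(_ 0) := @semigroup_continuous _ _ _ hT x.
rewrite /= in_itv/= lexx => /(_ isT).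
move=> /cvgrPdist_le/(_ e e0); rewrite near_withinE /= => -[d /= d0 hd].
(* The neighbourhood is an open ball of radius [d], whereas the closed range of [s] must fit inside
   it; hence the half. *)
exists (Num.min (d / 2) 1).
  by rewrite lt_min ltr01 divr_gt0//= ge_min lexx orbT.
move=> s /andP[s0]; rewrite le_min => /andP[sd _].
suff : `|T 0 x - T s x| <= e by rewrite (semigroup0 hT) distrC.
apply: (hd s); last by rewrite in_itv/= s0.
rewrite /ball_/= sub0r normrN ger0_norm// (le_lt_trans sd)//.
by rewrite ltr_pdivrMr// mulr_natr mulr2n ltrDl.
Qed.

(** * Consequences of assertion (iv): uniform bounds of orbits *)

Section LocallyBoundedOrbits.
Hypothesis orbit_bounded : forall x t0, 0 < t0 ->
  exists u, forall t, 0 <= t <= t0 -> absv (T t x) <=v u.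

(* By positivity, a bound for the orbit of [y] bounds the orbits of all
   elements of [[-y, y]]. Elements violating the estimate for [C = 4 ^ n] and
   scaled to norm [2 ^- n] lie in one such interval. *)
Lemma orbit_bound_uniform : exists2 C : R, 0 <= C & forall x,
  exists2 u, forall t, 0 <= t <= 1 -> absv (T t x) <=v u & `|u| <= C * `|x|.
Proof.
apply: contrapT => hC.
have bad n : exists x, forall u,
    (forall t, 0 <= t <= 1 -> absv (T t x) <=v u) ->
    4 ^+ n * `|x| < `|u|.
  apply: contrapT => hx; apply: hC; exists (4 ^+ n) => [|x].
    exact: exprn_ge0.
  apply: contrapT => hu; apply: hx; exists x => u ux.
  by rewrite ltNge; apply/negP => ?; apply: hu; exists u.
have [x hx] := choice bad.
have x_gt0 n : 0 < `|x n|.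
  (* If [x n] were zero, the bound 0 of its orbit would yield [0 < 0]. *)
  rewrite lt_def normr_ge0 andbT; apply/negP => /eqP/normr0P/eqP xn0.
  suff : 4 ^+ n * `|x n| < `|0 : E| by rewrite xn0 !normr0 mulr0 ltxx.
  apply: hx => t /andP[t0 _]; rewrite xn0 semigroup_v0//.
  by rewrite absv_id; exact: vle_refl.
pose c (n : nat) : R := 2 ^- n / `|x n|.
have c_gt0 n : 0 < c n by rewrite divr_gt0// invr_gt0 exprn_gt0.
have [||y y0 xy] := @dominating_vector R E (fun n => c n *: absv (x n)) 1.
- by move=> n; apply: scalev_vge0; [exact: ltW|exact: absv_ge0].
- by move=> n; rewrite normrZ normv_absv gtr0_norm// divfK ?gt_eqF// mul1r.
have [u yu] := orbit_bounded y ltr01.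
(* The orbit of [x n] is bounded by [(c n)^-1 *: u], whose norm therefore exceeds [4 ^+ n] times the
   norm of [x n]. As [(c n)^-1] is [2 ^+ n] times that norm, a factor [2 ^+ n] remains. *)
have lt_u n : 2 ^+ n < `|u|.
  have p_gt0 : 0 < `|x n| * 2 ^+ n by rewrite mulr_gt0// exprn_gt0.
  have cV : (c n)^-1 = `|x n| * 2 ^+ n by rewrite invf_div invrK.
  rewrite -(ltr_pM2l p_gt0) -cV -(gtr0_norm (c_gt0 n)) -normfV -normrZ.
  have -> : `|(c n)^-1| * 2 ^+ n = 4 ^+ n * `|x n|.
    rewrite cV gtr0_norm// -[4]/((2 * 2)%N%:R) natrM exprMn.
    by rewrite mulrC mulrA mulrAC.
  apply: hx.
  move=> t /andP[t0 t1].
  have : T t (absv (x n)) <=v (c n)^-1 *: u.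
    rewrite -[absv _](@scalerK _ _ (c n)) ?unitfE ?gt_eqF// semigroupZ//.
    apply: vleZ; first by rewrite invr_ge0 ltW.
    apply: vle_trans (semigroup_mono t0 (xy n)) _.
    by apply: vle_trans (vle_absv _) _; apply: yu; rewrite t0.
  apply: vle_trans; apply: absv_semigroup => //; exact: vle_refl.
have := lt_u (Num.truncn `|u|).+1; apply/negP; rewrite -leNgt.
have /andP[_ /ltW/le_trans] := Num.Theory.truncn_itv (normr_ge0 u); apply.
by rewrite -natrX ler_nat ltnW// ltn_expl.
Qed.

(** * Riemann means of an orbit and their limits *)

Section Averages.
Variable C : R.
Hypothesis C_ge0 : 0 <= C.
Hypothesis norm_semigroup_le : forall t x, 0 <= t <= 1 -> `|T t x| <= C * `|x|.

(** The left Riemann sum, with [n] equal steps, of the mean of [T s x] over [0 <= s <= h]. *)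
Definition average (h : R) (n : nat) x : E :=
  n%:R^-1 *: \sum_(0 <= k < n) T (k%:R * (h / n%:R)) x.

Lemma average_dist (h e : R) (n : nat) x : 0 <= h -> (0 < n)%N ->
  (forall s, 0 <= s <= h -> `|T s x - x| <= e) -> `|average h n x - x| <= e.
Proof.
move=> h0 n0 he; have nR : 0 < n%:R :> R by rewrite ltr0n.
have mean_const : n%:R^-1 *: \sum_(0 <= k < n) x = x.
  by rewrite sumr_const_nat subn0 -[x *+ n]scaler_nat scalerK// gt_eqF.
rewrite -[X in _ - X]mean_const -scalerBr -sumrB normrZ.
rewrite gtr0_norm ?invr_gt0// ler_pdivrMl//.
apply: le_trans (ler_norm_sum _ _ _) _.
apply: (@le_trans _ _ (\sum_(0 <= k < n) e)).
  apply: ler_sum_nat => k /= kn.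
  apply: he; rewrite mulr_ge0 ?divr_ge0 ?ler0n//= mulrCA -[leRHS]mulr1.
  by rewrite ler_wpM2l// ler_pdivrMr// mul1r ler_nat ltnW.
by rewrite sumr_const_nat subn0 mulr_natl.
Qed.

(** Each coarse node is repeated [m] times and paired with the fine nodes following it. By the
    semigroup law each difference is [T] at the coarse node applied to [T s x - x] with
    [s <= h / n%:R], which costs the factor [C]. *)
Lemma average_refine (h e : R) (n m : nat) x : 0 <= h <= 1 ->
  (0 < n)%N -> (0 < m)%N ->
  (forall s, 0 <= s <= h / n%:R -> `|T s x - x| <= e) ->
  `|average h (n * m) x - average h n x| <= C * e.
Proof.
move=> /andP[h0 h1] n0 m0 he.
have nR : 0 < n%:R :> R by rewrite ltr0n.
have mR : 0 < m%:R :> R by rewrite ltr0n.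
have -> : average h n x = (n * m)%:R^-1 *:
    \sum_(0 <= k < n) \sum_(0 <= j < m) T (k%:R * (h / n%:R)) x.
  rewrite natrM invfM -scalerA; congr (_ *: _).
  under [in RHS]eq_bigr do rewrite sumr_const_nat subn0 -[_ *+ m]scaler_nat.
  by rewrite -scaler_sumr scalerK// gt_eqF.
rewrite /average sum_mul_nat -scalerBr -sumrB normrZ.
have nm0 : 0 < (n * m)%:R :> R by rewrite ltr0n muln_gt0 n0.
rewrite gtr0_norm ?invr_gt0// ler_pdivrMl//.
apply: le_trans (ler_norm_sum _ _ _) _.
apply: (@le_trans _ _ (\sum_(0 <= k < n) \sum_(0 <= j < m) C * e)); last first.
  by rewrite !sumr_const_nat !subn0 -mulrnA [leRHS]mulr_natl mulnC.
apply: ler_sum_nat => k /= kn; rewrite -sumrB.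
apply: le_trans (ler_norm_sum _ _ _) _; apply: ler_sum_nat => j /= jm.
have -> : (k * m + j)%:R * (h / (n * m)%:R) =
    k%:R * (h / n%:R) + j%:R * (h / n%:R / m%:R) :> R.
  by rewrite natrD !natrM; field; rewrite !gt_eqF.
have k0 : 0 <= k%:R * (h / n%:R) by rewrite mulr_ge0 ?divr_ge0 ?ler0n.
have j0 : 0 <= j%:R * (h / n%:R / m%:R) by rewrite mulr_ge0 ?divr_ge0 ?ler0n.
rewrite (semigroupD hT)// -semigroupB//.
apply: le_trans (norm_semigroup_le _ _) _.
  rewrite k0/= mulrCA mulr_ile1 ?divr_ge0 ?ler0n//.
  by rewrite ler_pdivrMr// mul1r ler_nat ltnW.
rewrite ler_wpM2l//; apply: he; rewrite j0/= mulrCA -[leRHS]mulr1.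
rewrite ler_wpM2l ?divr_ge0 ?ler0n//.
by rewrite ler_pdivrMr// mul1r ler_nat ltnW.
Qed.

(** A shift by [j] steps maps nodes to nodes, so the difference of the two sums reduces to [j]
    differences of orbit values. Each is bounded by [u + u], and [2 * j / n] equals
    [j * (h / n) * (2 / h)]. *)
Lemma average_shift (h : R) (n j : nat) x u : 0 < h -> (0 < n)%N ->
  (forall t, 0 <= t <= h + j%:R * (h / n%:R) -> absv (T t x) <=v u) ->
  absv (T (j%:R * (h / n%:R)) (average h n x) - average h n x)
    <=v (j%:R * (h / n%:R)) *: ((2 / h) *: u).
Proof.
move=> h0 n0 hu; have nR : 0 < n%:R :> R by rewrite ltr0n.
have step0 k : 0 <= k%:R * (h / n%:R).
  by rewrite mulr_ge0 ?divr_ge0 ?ler0n// ltW.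
pose f k := T (k%:R * (h / n%:R)) x.
have -> : T (j%:R * (h / n%:R)) (average h n x) - average h n x =
    n%:R^-1 *: \sum_(0 <= k < j) (f (n + k)%N - f k).
  rewrite -sum_shiftB sumrB scalerBr semigroupZ// semigroup_sum//.
  congr (_ *: _ - _); apply: eq_bigr => k _.
  by rewrite -(semigroupD hT)// -mulrDl -natrD addnC.
have -> : (j%:R * (h / n%:R)) *: ((2 / h) *: u) =
    n%:R^-1 *: \sum_(0 <= k < j) (u + u).
  rewrite sumr_const_nat subn0 -mulr2n -mulrnA.
  rewrite -[u *+ _]scaler_nat !scalerA natrM.
  by congr (_ *: _); field; rewrite !gt_eqF.
have bound k : (k < j)%N -> absv (f (n + k)%N - f k) <=v u + u.
  move=> kj; have kj' : k%:R * (h / n%:R) <= j%:R * (h / n%:R).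
    by apply: ler_wpM2r; [rewrite divr_ge0 ?ler0n ?ltW|rewrite ler_nat ltnW].
  apply: vle_trans (absvD _ _) _; rewrite absvN; apply: vleD; apply: hu.
    by rewrite step0 natrD mulrDl mulrCA divff ?gt_eqF// mulr1 lerD2l.
  by rewrite step0 (le_trans kj')// lerDr ltW.
apply: absvZ_le; rewrite ?invr_ge0 ?ler0n// !big_mkord.
by apply: absv_sum => i _; exact: bound.
Qed.

(** Means with [m.+1] and [n.+1] nodes are both compared with the one on their common refinement.
    Successors avoid the degenerate mean without nodes. *)
Lemma average_cvg (h : R) x : 0 < h <= 1 ->
  exists a, forall e, 0 < e -> exists N, forall n, (N < n)%N ->
    `|a - average h n x| <= e.
Proof.
move=> /andP[h0 h1].
have [|a ha] := @cauchy_limit R E (fun n => average h n.+1 x); last first.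
  by exists a => e /ha[N hN]; exists N => -[//|n] /hN.
(* [C + 1] replaces [C] in the denominator because [C] may be zero. *)
move=> e e0; have C1 : 0 < 2 * (C + 1) by rewrite mulr_gt0// ltr_wpDl.
have [d /andP[d0 _] hd] := semigroup_cvg0 x (divr_gt0 e0 C1).
exists (Num.truncn d^-1) => m n dm dn.
have refine k l : (Num.truncn d^-1 <= k)%N ->
    `|average h (k.+1 * l.+1) x - average h k.+1 x| <= e / 2.
  move=> dk.
  apply: le_trans (average_refine _ _ _ (e := e / (2 * (C + 1))) _) _ => //.
  - by rewrite h1 ltW.
  - move=> s /andP[s0 sh]; apply: hd; rewrite s0/= (le_trans sh)//.
    exact: div_succn_truncn_le.
  - have C1' : 0 < C + 1 by rewrite ltr_wpDl.
    have -> : C * (e / (2 * (C + 1))) = e / 2 * (C / (C + 1)).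
      by field; rewrite gt_eqF.
    rewrite ler_piMr ?divr_ge0 ?ltW//.
    by rewrite ltr_pdivrMr// mul1r ltrDl.
rewrite -(subrKA (average h (m.+1 * n.+1) x)) [e]splitr.
apply: le_trans (ler_normD _ _) _; apply: lerD; last by rewrite mulnC refine.
by rewrite distrC refine.
Qed.

Lemma locally_lipschitz_dense x (e : R) : 0 < e ->
  exists a v, [/\ `|a - x| <= e, 0 <=v v &
    forall t, 0 <= t <= 1 -> absv (T t a - a) <=v t *: v].
Proof.
move=> e0.
have [h /andP[h0 h1] hx] := semigroup_cvg0 x (divr_gt0 e0 (ltr0Sn R 1)).
have h01 : 0 < h <= 1 by rewrite h0.
have [a ha] := average_cvg x h01.
(* The orbit is followed up to time 2: averaging takes time [h <= 1] and the shift at most 1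
   more. *)
have [u hu] := orbit_bounded x (ltr0Sn R 1).
have u0 : 0 <=v u.
  by apply: vle_trans (absv_ge0 (T 0 x)) _; apply: hu; rewrite lexx ler0n.
have v0 : 0 <=v (2 / h) *: u by apply: scalev_vge0 => //; rewrite divr_ge0 ?ltW.
exists a, ((2 / h) *: u); split => //.
  have [N hN] := ha _ (divr_gt0 e0 (ltr0Sn R 1)).
  rewrite -(subrKA (average h N.+1 x)) [e]splitr.
  apply: le_trans (ler_normD _ _) _; apply: lerD; first exact: hN.
  by apply: average_dist => //; exact: ltW.
move=> t /andP[t0 t1]; apply: absv_closed => r r0.
have C1 : 0 < 2 * C + 1 by rewrite ltr_wpDl// mulr_ge0.
(* Three errors will add up to [C * r1 + C * r1 + r1 = r]. *)
pose r1 := r / (2 * C + 1).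
have r10 : 0 < r1 by rewrite divr_gt0.
have [d /andP[d0 _] hd] := semigroup_cvg0 a r10.
have [N hN] := ha _ r10.
(* Both requirements on [n] are met: the mean is within [r1] of [a], and the mesh [tau] is at most
   [d]. *)
pose n := (maxn N (Num.truncn d^-1)).+1.
have n0 : 0 < n%:R :> R by rewrite ltr0n.
pose tau := h / n%:R; have tau0 : 0 < tau by rewrite divr_gt0.
have /Num.Theory.truncn_itv : 0 <= t / tau by rewrite divr_ge0// ltW.
(* The time [t] is rounded down to the multiple [j%:R * tau] of the mesh, where the estimate for
   shifted means applies; the remainder is less than [tau]. *)
set j := Num.truncn _; rewrite ler_pdivlMr// ltr_pdivrMr// => /andP[jt tj].
have j0 : 0 <= j%:R * tau by rewrite mulr_ge0 ?ler0n ?ltW.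
have tj0 : 0 <= t - j%:R * tau by rewrite subr_ge0.
exists (T (j%:R * tau) (average h n x) - average h n x).
  apply: vle_trans (average_shift (u := u) _ _ _) _ => //.
    move=> s /andP[s0 sh]; apply: hu; rewrite s0/= (le_trans sh)//.
    by rewrite -[2]/(1 + 1) lerD// (le_trans jt).
  exact: vleZl.
have -> : T t a - a - (T (j%:R * tau) (average h n x) - average h n x) =
    T (j%:R * tau) (T (t - j%:R * tau) a - a) +
    T (j%:R * tau) (a - average h n x) - (a - average h n x).
  rewrite -semigroup_add// subrKA semigroupB// -(semigroupD hT)//.
  rewrite [j%:R * tau + _]addrC subrK.
  by rewrite !opprB addrACA [RHS]addrACA [- a - _]addrC.
have j1 : 0 <= j%:R * tau <= 1 by rewrite j0 (le_trans jt).
have an : `|a - average h n x| <= r1 by apply: hN; rewrite ltnS leq_maxl.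
have -> : r = C * r1 + C * r1 + r1 by rewrite /r1; field; rewrite gt_eqF.
apply: le_trans (ler_normB _ _) _; apply: lerD => //.
apply: le_trans (ler_normD _ _) _; apply: lerD;
  apply: le_trans (norm_semigroup_le _ j1) _; rewrite ler_wpM2l//.
apply: hd; rewrite tj0/= lerBlDr.
apply: le_trans (ltW tj) _; rewrite -natr1 mulrDl mul1r addrC lerD2r.
by apply: div_succn_truncn_le => //; rewrite leq_maxr.
Qed.

End Averages.
(** Replacing [x] by [a n] costs two terms bounded by [u n], uniformly for [t <= 1]; what remains is
    at most [t *: v n]. Given [e], first [n] is fixed to control the former, then [t] is made small
    depending on [n]. *)
Lemma ru_continuous x :
  ru_cvg (@dir0 R) (fun t : {posnum R} => T t%:num x) x.
Proof.
have [C C0 hC] := orbit_bound_uniform.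
have norm_T t y : 0 <= t <= 1 -> `|T t y| <= C * `|y|.
  by move=> t01; have [u /(_ t t01)/norm_absv_le/le_trans + uy] := hC y; apply.
(* The components of [p n] are [a n], [v n] and [u n], in this order. *)
have /choice[p hp] (n : nat) : exists p : E * E * E,
    [/\ forall t, 0 <= t <= 1 -> absv (T t (p.1.1 - x)) <=v p.2,
        `|p.2| <= C * 4 ^- n, 0 <=v p.1.2 &
        forall t, 0 <= t <= 1 -> absv (T t p.1.1 - p.1.1) <=v t *: p.1.2].
  have pow0 : 0 < 4 ^- n :> R by rewrite invr_gt0 exprn_gt0.
  have [a [v [ax v0 hv]]] := locally_lipschitz_dense C0 norm_T x pow0.
  have [u hu ua] := hC (a - x).
  by exists (a, v, u); split => //=; apply: le_trans ua _; rewrite ler_wpM2l.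
pose a n := (p n).1.1; pose v n := (p n).1.2; pose u n := (p n).2.
have ha n : absv (a n - x) <=v u n.
  by have [/(_ 0) + _ _ _] := hp n; rewrite (semigroup0 hT); apply;
    rewrite lexx ler01.
(* The decay [4 ^- n] pays for the weight [2 ^+ n] and still leaves summable norms, so [u n] is at
   most [2 ^- n *: w]. *)
have [n||w w0 uw] := @dominating_vector R E (fun n => 2 ^+ n *: u n) C.
- apply: scalev_vge0; first exact: exprn_ge0.
  exact: vle_trans (absv_ge0 _) (ha n).
- move=> n; rewrite normrZ gtr0_norm ?exprn_gt0// -ler_pdivlMl ?exprn_gt0//.
  have [_ + _ _] := hp n.
  by rewrite -[4]/((2 * 2)%N%:R) natrM exprMn invfM mulrCA.
(* No bound on the norms of the [v n] is available, so [c n] normalizes them; adding 1 keeps the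
   divisor positive if [v n] is zero. *)
pose c n := 2 ^- n / (`|v n| + 1) : R.
have v1 n : 0 < `|v n| + 1 by rewrite ltr_wpDl.
have c0 n : 0 < c n by rewrite divr_gt0// invr_gt0 exprn_gt0.
have [n||z z0 vz] := @dominating_vector R E (fun n => c n *: v n) 1.
- by have [_ _ v0 _] := hp n; apply: scalev_vge0 => //; exact: ltW.
- move=> n; rewrite normrZ gtr0_norm// mul1r /c -mulrA.
  rewrite ler_piMr ?invr_ge0 ?exprn_ge0//.
  by rewrite ler_pdivrMl// mulr1 lerDl.
exists (w + z); split; first exact: addv_ge0.
move=> e e0; pose n := (Num.truncn (2 / e)).+1.
have en : 2 * 2 ^- n <= e.
  rewrite ler_pdivrMr ?exprn_gt0// -ler_pdivrMl// mulrC.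
  have /Num.Theory.truncn_itv/andP[_ /ltW/le_trans] : 0 <= 2 / e.
    by rewrite divr_ge0// ltW.
  by apply; rewrite -natrX ler_nat ltnW// ltn_expl.
(* The bound 1 gives access to the orbit estimates; the bound [e * c n] turns [t *: v n] into at
   most [e *: z]. *)
have d0 : 0 < Num.min 1 (e * c n) by rewrite lt_min ltr01 mulr_gt0.
exists (PosNum d0) => t; rewrite /dir0 /= le_min => /andP[t1 tc].
have t01 : 0 <= t%:num <= 1 by rewrite t1 andbT.
have [hu _ v0 hv] := hp n.
have -> : T t%:num x - x =
    - T t%:num (a n - x) + (a n - x) + (T t%:num (a n) - a n).
  by rewrite semigroupB// opprB [RHS]addrC addrCA !subrKA.
apply: (@vle_trans _ _ (u n + u n + t%:num *: v n)).
  apply: vle_trans (absvD _ _) _; apply: vleD; last exact: hv.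
  apply: vle_trans (absvD _ _) _; rewrite absvN; apply: vleD; last exact: ha.
  exact: hu.
rewrite scalerDr; apply: vleD.
  have -> : u n + u n = (2 * 2 ^- n) *: (2 ^+ n *: u n).
    by rewrite scalerA -mulrA mulVf ?expf_neq0// mulr1 scaler_nat mulr2n.
  apply: vle_trans (vleZl en w0); apply: vleZ (uw n).
  by rewrite mulr_ge0// invr_ge0 exprn_ge0.
have -> : t%:num *: v n = (t%:num / c n) *: (c n *: v n).
  by rewrite scalerA divfK// gt_eqF.
apply: vle_trans (vleZ _ (vz n)) _; first by rewrite divr_ge0// ltW.
by apply: vleZl => //; rewrite ler_pdivrMr.
Qed.

End LocallyBoundedOrbits.
End PositiveSemigroups.

(** * The remaining implications *)

Lemma order_boundedP (R : realType) (E : banachLatticeType R) (A : set E) :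
  order_bounded A <-> exists u, forall x, A x -> absv x <=v u.
Proof.
split=> [[a [b Aab]]|[u Au]].
  exists (absv b + absv (a : E)) => x /Aab; rewrite /= in_itv /= => /andP[ax xb].
  rewrite absv_le; apply/andP; split.
    rewrite -[x]addr0; apply: vleD (absv_ge0 _).
    exact: vle_trans xb (vle_absv _).
  rewrite -[- x]add0r; apply: vleD; first exact: absv_ge0.
  by apply: vle_trans (vleN_absv (a : E)); rewrite vleN2.
exists (- u), u => x /Au; rewrite absv_le => /andP[xu Nxu].
by rewrite /= in_itv /= xu andbT -vleN2 opprK.
Qed.

(** The multiples [n.+1%:R^-1 *: u] of the regulator serve as the decreasing net. They tend to 0 in
    norm, so closedness of the order puts every lower bound below 0. *)
Lemma ru_cvg_order_cvg (R : realType) (E : banachLatticeType R) (J : Type)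
    (leJ : J -> J -> Prop) (x : J -> E) (l : E) :
  ru_cvg leJ x l -> order_cvg leJ x l.
Proof.
move=> [u [u0 hu]].
exists nat, (fun m n => (m <= n)%N), (fun n => n.+1%:R^-1 *: u); split.
- split=> //; first exact: (inhabits 0%N).
  + by move=> i j k; exact: leq_trans.
  + by move=> i j; exists (maxn i j); rewrite leq_maxl leq_maxr.
- by move=> h k hk; apply: vleZl => //; rewrite lef_pV2 ?posrE ?ltr0n// ler_nat.
- split=> [_ [n _ <-]|y hy].
    by apply: scalev_vge0; rewrite ?invr_ge0.
  apply: vle_closed => e e0; exists y.
  have u1 : 0 < `|u| + 1 by rewrite ltr_wpDl.
  pose n := Num.truncn (e / (`|u| + 1))^-1.
  exists (n.+1%:R^-1 *: u); split; first by apply: hy; exists n.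
    by rewrite subrr normr0 ltW.
  rewrite sub0r normrN normrZ gtr0_norm ?invr_gt0//.
  have := div_succn_truncn_le (lexx 1) (divr_gt0 e0 u1) (leqnn n).
  rewrite mul1r ler_pdivlMr//; apply: le_trans.
  by rewrite ler_wpM2l ?invr_ge0// lerDl.
- move=> n; by apply: hu; rewrite invr_gt0.
Qed.

(** Induction on the number of steps of length [tx]: beyond [tx], [T t x] is [T tx] applied to an
    earlier orbit point, and positivity carries the bound [v] to [T tx v]. *)
Lemma orbit_bounded_extend (R : realType) (E : banachLatticeType R)
    (T : R -> E -> E) (hT : positive_C0_semigroup T) (x u : E) (tx : R) :
  0 < tx -> (forall t, 0 <= t <= tx -> absv (T t x) <=v u) ->
  forall t0, exists v, forall t, 0 <= t <= t0 -> absv (T t x) <=v v.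
Proof.
move=> tx0 hu t0.
have u0 : 0 <=v u.
  by apply: vle_trans (absv_ge0 (T 0 x)) _; apply: hu; rewrite lexx ltW.
(* The truncation plus one counts enough steps to pass [t0]; the maximum with 0 covers negative
   [t0]. *)
suff [v hv] : exists v, forall t,
    0 <= t <= (Num.truncn (Num.max 0 t0 / tx)).+1%:R * tx -> absv (T t x) <=v v.
  exists v => t /andP[t_ge0 tt]; apply: hv; rewrite t_ge0/= -ler_pdivrMr//.
  have /Num.Theory.truncn_itv/andP[_ /ltW le_n] : 0 <= Num.max 0 t0 / tx.
    by rewrite divr_ge0 ?le_max ?lexx// ltW.
  by apply: (le_trans _ le_n); rewrite ler_pM2r ?invr_gt0// le_max tt orbT.
elim: (Num.truncn _).+1 => [|n [v hv]].
  exists u => t /andP[t_ge0]; rewrite mul0r => t_le0; apply: hu.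
  by rewrite t_ge0 (le_trans t_le0)// ltW.
have v0 : 0 <=v v.
  apply: vle_trans (absv_ge0 (T 0 x)) _; apply: hv.
  by rewrite lexx mulr_ge0 ?ler0n// ltW.
have tx_ge0 := ltW tx0.
exists (u + T tx v) => t /andP[t_ge0 tn]; have [t_le|t_gt] := leP t tx.
  rewrite -[absv _]addr0; apply: vleD; first by apply: hu; rewrite t_ge0.
  exact: (semigroup_positive hT).
have t_tx : 0 <= t - tx by rewrite subr_ge0 ltW.
rewrite -[absv _]add0r; apply: vleD => //.
rewrite -[t](subrK tx) addrC (semigroupD hT)//.
apply: absv_semigroup => //; apply: hv; rewrite t_tx/= lerBlDr.
by rewrite -[X in _ + X]mul1r -mulrDl natr1.
Qed.

Theorem theorem2p1 (R : realType) (E : banachLatticeType R) (T : R -> E -> E)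
    (hT : positive_C0_semigroup T) :
  [<-> forall x : E, ru_cvg (@dir0 R) (fun t => T t%:num x) x;
       forall x : E, order_cvg (@dir0 R) (fun t => T t%:num x) x;
       forall x : E, exists tx : R, 0 < tx /\
         order_bounded [set T t x | t in `[0, tx]];
       forall (x : E) (t0 : R), 0 < t0 ->
         order_bounded [set T t x | t in `[0, t0]]].
Proof.
tfae.
- by move=> h x; exact: ru_cvg_order_cvg.
- move=> h x; have [H [leH [y [[[i] _ _ _] _ [y0 _] hy]]]] := h x.
  (* A single member [y i] of the dominating net suffices: it bounds [absv (T t x - x)] for all
     small [t > 0]. *)
  have [t0 ht0] := hy i; exists t0%:num; split=> //.
  apply/order_boundedP; exists (y i + absv x) => _ [t /= + <-].
  rewrite in_itv /= => /andP[t_ge0 t_le].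
  rewrite -[T t x](subrK x); apply: vle_trans (absvD _ _) _.
  (* The net is indexed by [t > 0] only. At [t = 0] the difference vanishes, and [y i] is positive
     because 0 is the infimum. *)
  rewrite vle_add2r; move: t_ge0; rewrite le_eqVlt => /predU1P[<-|t_gt0].
    rewrite (semigroup0 hT) subrr absv_id ?vle_refl//.
    by apply: y0; exists i.
  exact: (ht0 (PosNum t_gt0)).
- move=> h x t0 _; have [tx [tx0 /order_boundedP[u hu]]] := h x.
  have hux t : 0 <= t <= tx -> absv (T t x) <=v u.
    by move=> t_itv; apply: hu; exists t; rewrite //= in_itv.
  have [v hv] := orbit_bounded_extend hT tx0 hux t0.
  apply/order_boundedP; exists v => _ [t /= + <-].
  by rewrite in_itv; exact: hv.
- move=> h; apply: ru_continuous => // x t0 t0_gt0.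
  have /order_boundedP[u hu] := h x t0 t0_gt0.
  by exists u => t t_itv; apply: hu; exists t; rewrite //= in_itv.
Qed.
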